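(* There exist two odometers $(X,\sigma)$ and $(Y,\tau)$ on the Cantor set such that the $\mathcal{L}$-structures $(C(X),\sigma)$ and $(C(Y),\tau)$ are not elementarily equivalent. In particular, the theory $T_{Cantor-A}$ is not complete.
   Context: Let $\mathcal{L}_{C^*}$ be the language of unital C*-algebras (continuous logic) and $\mathcal{L}$ its expansion by a unary function symbol $\sigma$. A compact space $X$ with a homeomorphism $S$ corresponds to the $\mathcal{L}$-structure $(C(X),\sigma)$ with $\sigma(f)=f\circ S$ (the same symbol is used for the homeomorphism and the induced automorphism). $T_{Cantor-A}$ is the $\mathcal{L}$-theory whose models are exactly the structures $(C(X),\sigma)$ with $X$ a compact $0$-dimensional Hausdorff space without isolated points and $\sigma$ an automorphism of $C(X)$. Odometers: given integers $a_n\ge 2$ ($n\ge1$), let $A_n=\{0,\dots,a_n-1\}$ and $X=\prod_n A_n$ with the product topology; define $\sigma:X\to X$ by ''adding $1$ in the first coordinate with carry to the right'': if $b_1<a_1-1$ then $\sigma(b)=(b_1+1,b_2,\dots)$; otherwise $\sigma(b)=(0,\dots,0,b_n+1,b_{n+1},\dots)$ where $n$ is least with $b_n<a_n-1$, and $\sigma(b)=(0,0,\dots)$ if no such $n$ exists. An odometer is any system topologically conjugate to such a $(\prod A_n,\sigma)$. *)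

(* Defs.v *)
From HB Require Import structures.
From mathcomp Require Import all_boot all_order all_algebra complex.
From mathcomp Require Import all_classical all_reals.
From mathcomp Require Import topology normedtype sequences cantor.

Set Implicit Arguments.
Unset Strict Implicit.
Unset Printing Implicit Defensive.
Import Order.TTheory GRing.Theory Num.Theory.
Import numFieldTopology.Exports numFieldNormedType.Exports.
Local Open Scope classical_set_scope.
Local Open Scope ring_scope.

HB.instance Definition _ (R : rcfType) :=
  NormedModule.copy R[i] (R[i] : numFieldType)^o.

(* The modulus as an element of R; the library's `|z| lives in R[i]. *)
Definition cabs (R : rcfType) (z : R[i]) : R := complex.Re `|z|.

Section cabs_theory.
Variable R : rcfType.
Implicit Types (z w : R[i]) (e : R).

Lemma cabsE z : `|z| = (cabs z)%:C%C.
Proof. by rewrite /cabs normc_def. Qed.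

Lemma cabs_ge0 z : 0 <= cabs z.
Proof. by rewrite -lecR -cabsE normr_ge0. Qed.

Lemma cabs0 : cabs (0 : R[i]) = 0.
Proof. by apply: complexI; rewrite -cabsE normr0. Qed.

Lemma cabs_eq0 z : cabs z = 0 -> z = 0.
Proof. by move=> z0; apply/normr0_eq0; rewrite cabsE z0. Qed.

Lemma cabsD z w : cabs (z + w) <= cabs z + cabs w.
Proof. by rewrite -lecR rmorphD /= -!cabsE ler_normD. Qed.

Lemma cabsM z w : cabs (z * w) = cabs z * cabs w.
Proof. by apply: complexI; rewrite rmorphM /= -!cabsE normrM. Qed.

Lemma cabsJ z : cabs z^* = cabs z.
Proof. by apply: complexI; rewrite -!cabsE norm_conjC. Qed.

Lemma cabsB z w : cabs (z - w) = cabs (w - z).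
Proof. by apply: complexI; rewrite -!cabsE distrC. Qed.

Lemma ler_cabs_Re z : `|complex.Re z| <= cabs z.
Proof. by rewrite -lecR -cabsE normc_ge_Re. Qed.

Lemma ler_cabs_Im z : `|complex.Im z| <= cabs z.
Proof.
have -> : complex.Im z = - complex.Re ('i%C * z).
  by case: z => a b /=; rewrite mul0r mul1r sub0r opprK.
rewrite normrN (le_trans (ler_cabs_Re _))// cabsM.
have -> : cabs ('i%C : R[i]) = 1.
  by rewrite /cabs normc_def /= expr0n expr1n add0r sqrtr1.
by rewrite mul1r.
Qed.

Lemma cabs_le_ReIm z : cabs z <= `|complex.Re z| + `|complex.Im z|.
Proof.
rewrite /cabs normc_def /= -[leRHS]ger0_norm ?addr_ge0//.
rewrite -(sqrtr_sqr (`|_| + _)); apply: ler_wsqrtr; rewrite sqrrD !real_normK ?num_real// addrAC lerDl.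
by rewrite mulrn_wge0// mulr_ge0.
Qed.

End cabs_theory.

Section continuous_complex.
Context {R : realType} {X : topologicalType}.
Implicit Types f g : X -> R[i].

Lemma continuous_cabsP f :
  continuous f <->
  forall x (e : R), 0 < e -> \forall y \near x, cabs (f x - f y) < e.
Proof.
split=> [cf x e e0|cf x].
  have eC : 0 < e%:C%C by rewrite ltcR.
  move/cvgrPdist_lt: (cf x) => /(_ _ eC); apply: filterS => y.
  by rewrite cabsE ltcR.
apply/cvgrPdist_lt => e e0.
have eE : e = (complex.Re e)%:C%C.
  by move: e0; rewrite ltcE /= => /andP[/eqP i0 _]; case: e i0 => a b /= ->.
have /cf : 0 < complex.Re e by rewrite -ltcR -eE.
by move=> /(_ x); apply: filterS => y; rewrite eE cabsE ltcR.
Qed.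

Lemma continuous_conj f : continuous f -> continuous (fun x => (f x)^*).
Proof.
move=> /continuous_cabsP cf; apply/continuous_cabsP => x e /(cf x).
by apply: filterS => y; rewrite -rmorphB cabsJ.
Qed.

Lemma continuous_cabs f : continuous f -> continuous (fun x => cabs (f x) : R).
Proof.
move=> /continuous_cabsP cf x; apply/cvgrPdist_lt => e /(cf x).
apply: filterS => y; apply: le_lt_trans.
rewrite ler_norml lerNl opprB !lerBlDr; apply/andP; split.
  by rewrite cabsB; apply: le_trans (cabsD _ _); rewrite subrK.
by apply: le_trans (cabsD _ _); rewrite subrK.
Qed.

End continuous_complex.

Lemma cauchy_complex (R : realType) (u : nat -> R[i]) :
  (forall e : R, 0 < e -> exists N, forall m n,
     (N <= m)%N -> (N <= n)%N -> cabs (u m - u n) < e) ->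
  exists l, forall e : R, 0 < e -> exists N, forall n,
     (N <= n)%N -> cabs (u n - l) < e.
Proof.
move=> cu.
have key (p : R[i] -> R) : {morph p : x y / x - y} ->
    (forall z, `|p z| <= cabs z) -> exists l : R, forall e, 0 < e ->
    exists N, forall n, (N <= n)%N -> `|p (u n) - l| < e.
  move=> pB ple; have /cauchy_cvgP cv : cauchy (p (u n) @[n --> \oo]).
    apply: cauchy_exP => e e0; have [N NP] := cu _ e0.
    exists (p (u N)); exists N => // n /= Nn; rewrite -ball_normE /=.
    by rewrite -pB (le_lt_trans (ple _))// NP.
  exists (lim (p (u n) @[n --> \oo])) => e e0.
  have /cvgrPdist_lt/(_ e e0)[N _ NP] := cv.
  by exists N => n /NP; rewrite distrC.
have [a aP] := key (@complex.Re R) (raddfB _) (@ler_cabs_Re R).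
have [b bP] := key (@complex.Im R) (raddfB _) (@ler_cabs_Im R).
exists (a +i* b)%C => e e0; have e20 : 0 < e / 2 by rewrite divr_gt0.
have [[N NP] [M MP]] := (aP _ e20, bP _ e20).
exists (maxn N M) => n; rewrite geq_max => /andP[/NP Nn /MP Mn].
rewrite (le_lt_trans (cabs_le_ReIm _))// !raddfB /= (splitr e).
exact: ltrD.
Qed.

(* Nonzero unital C*-algebras over the complex numbers R[i]: an algType has
   1 != 0. *)
HB.mixin Record isCStarAlgebra (R : realType) A of GRing.Algebra R[i] A := {
  star : A -> A;
  cnorm : A -> R;
  starK : forall x, star (star x) = x;
  starD : forall x y, star (x + y) = star x + star y;
  starM : forall x y, star (x * y) = star y * star x;
  starZ : forall (a : R[i]) x, star (a *: x) = a^* *: star x;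
  cnorm_eq0 : forall x, cnorm x = 0 -> x = 0;
  cnormD : forall x y, cnorm (x + y) <= cnorm x + cnorm y;
  cnormZ : forall (a : R[i]) x, cnorm (a *: x) = cabs a * cnorm x;
  cnormM : forall x y, cnorm (x * y) <= cnorm x * cnorm y;
  cstar_identity : forall x, cnorm (star x * x) = cnorm x ^+ 2;
  cnorm_complete : forall u : nat -> A,
    (forall e, 0 < e -> exists N, forall m n,
       (N <= m)%N -> (N <= n)%N -> cnorm (u m - u n) < e) ->
    exists l, forall e, 0 < e -> exists N, forall n,
       (N <= n)%N -> cnorm (u n - l) < e
}.

#[short(type="cstarType")]
HB.structure Definition CStarAlgebra (R : realType) :=
  {A of GRing.Algebra R[i] A & isCStarAlgebra R A}.

(* Nonempty (ptopologicalType has a point) compact Hausdorff spaces. *)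
Record compact_space := CompactSpace {
  space_of :> ptopologicalType;
  space_compact : compact [set: space_of];
  space_hausdorff : hausdorff_space space_of
}.

Definition CX (R : realType) (X : compact_space) : Type :=
  continuousType X R[i].
HB.instance Definition _ R X := Choice.on (CX R X).

Section CX_algebra.
Context {R : realType} {X : compact_space}.
Implicit Types f g h : CX R X.

Definition CX_fun f : X -> R[i] := Continuous.sort f.
Local Coercion CX_fun : CX >-> Funclass.

Definition mkCX (f : X -> R[i]) (cf : continuous f) : CX R X :=
  [the continuousType X R[i] of mkcts cf].

Lemma CX_continuous f : continuous f.
Proof. exact: cts_fun. Qed.

Lemma CXP f g : (forall x, f x = g x) -> f = g.
Proof. by move=> fg; apply/continuousEP. Qed.

Fact CX_zero_cts : continuous (fun _ : X => 0 : R[i]).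
Proof. by move=> x; exact: cvg_cst. Qed.
Fact CX_one_cts : continuous (fun _ : X => 1 : R[i]).
Proof. by move=> x; exact: cvg_cst. Qed.
Fact CX_opp_cts f : continuous (fun x => - f x).
Proof. by move=> x; apply: (@cvgN R[i] R[i]); exact: CX_continuous. Qed.
Fact CX_add_cts f g : continuous (fun x => f x + g x).
Proof. by move=> x; apply: (@cvgD R[i] R[i]); exact: CX_continuous. Qed.
Fact CX_mul_cts f g : continuous (fun x => f x * g x).
Proof.
move=> x; apply: (@cvgM (R[i] : numFieldType)); exact: CX_continuous.
Qed.
Fact CX_scale_cts (a : R[i]) f : continuous (fun x => a * f x).
Proof.
move=> x; apply: (@cvgM (R[i] : numFieldType)); last exact: CX_continuous.
exact: cvg_cst.
Qed.
Fact CX_star_cts f : continuous (fun x => (f x)^*).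
Proof. by apply: continuous_conj; exact: CX_continuous. Qed.

Definition CX_zero := mkCX CX_zero_cts.
Definition CX_one := mkCX CX_one_cts.
Definition CX_opp f := mkCX (@CX_opp_cts f).
Definition CX_add f g := mkCX (@CX_add_cts f g).
Definition CX_mul f g := mkCX (@CX_mul_cts f g).
Definition CX_scale a f := mkCX (@CX_scale_cts a f).
Definition CX_star f := mkCX (@CX_star_cts f).
Definition CX_norm f : R := sup (range (fun x => cabs (f x))).

Fact CX_addA : associative CX_add.
Proof. by move=> f g h; apply: CXP => x; exact: addrA. Qed.
Fact CX_addC : commutative CX_add.
Proof. by move=> f g; apply: CXP => x; exact: addrC. Qed.
Fact CX_add0 : left_id CX_zero CX_add.
Proof. by move=> f; apply: CXP => x; exact: add0r. Qed.
Fact CX_addN : left_inverse CX_zero CX_opp CX_add.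
Proof. by move=> f; apply: CXP => x; exact: addNr. Qed.
HB.instance Definition _ :=
  GRing.isZmodule.Build (CX R X) CX_addA CX_addC CX_add0 CX_addN.

Fact CX_mulA : associative CX_mul.
Proof. by move=> f g h; apply: CXP => x; exact: mulrA. Qed.
Fact CX_mul1l : left_id CX_one CX_mul.
Proof. by move=> f; apply: CXP => x; exact: mul1r. Qed.
Fact CX_mul1r : right_id CX_one CX_mul.
Proof. by move=> f; apply: CXP => x; exact: mulr1. Qed.
Fact CX_mulDl : left_distributive CX_mul +%R.
Proof. by move=> f g h; apply: CXP => x; exact: mulrDl. Qed.
Fact CX_mulDr : right_distributive CX_mul +%R.
Proof. by move=> f g h; apply: CXP => x; exact: mulrDr. Qed.
Fact CX_oner_neq0 : CX_one != 0.
Proof.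
apply/eqP => /(congr1 (fun f : CX R X => f point)) /= /eqP.
by rewrite oner_eq0.
Qed.
HB.instance Definition _ := GRing.Zmodule_isNzRing.Build (CX R X)
  CX_mulA CX_mul1l CX_mul1r CX_mulDl CX_mulDr CX_oner_neq0.

Fact CX_scaleA a b f : CX_scale a (CX_scale b f) = CX_scale (a * b) f.
Proof. by apply: CXP => x; exact: mulrA. Qed.
Fact CX_scale1 : left_id 1 CX_scale.
Proof. by move=> f; apply: CXP => x; exact: mul1r. Qed.
Fact CX_scaleDr : right_distributive CX_scale +%R.
Proof. by move=> a f g; apply: CXP => x; exact: mulrDr. Qed.
Fact CX_scaleDl f : {morph CX_scale^~ f : a b / a + b}.
Proof. by move=> a b; apply: CXP => x; exact: mulrDl. Qed.
HB.instance Definition _ := GRing.Zmodule_isLmodule.Build R[i] (CX R X)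
  CX_scaleA CX_scale1 CX_scaleDr CX_scaleDl.

Fact CX_scaleAl (a : R[i]) f g : a *: (f * g) = a *: f * g.
Proof. by apply: CXP => x; exact: mulrA. Qed.
HB.instance Definition _ :=
  GRing.Lmodule_isLalgebra.Build R[i] (CX R X) CX_scaleAl.

Fact CX_scaleAr (a : R[i]) f g : a *: (f * g) = f * (a *: g).
Proof. by apply: CXP => x; exact: mulrCA. Qed.
HB.instance Definition _ :=
  GRing.Lalgebra_isAlgebra.Build R[i] (CX R X) CX_scaleAr.

Lemma CX_has_sup f : has_sup (range (fun x => cabs (f x))).
Proof.
split; first by exists (cabs (f point)); exists point.
have cf : continuous (fun x => cabs (f x)).
  by apply: continuous_cabs; exact: CX_continuous.
have /compact_bounded[M [_ MP]] : compact (range (fun x => cabs (f x))).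
  apply: continuous_compact; last exact: space_compact.
  exact: continuous_subspaceT.
exists (M + 1) => _ [x _ <-]; rewrite (le_trans (ler_norm _))//.
by apply: (MP (M + 1)); [rewrite ltrDl|exists x].
Qed.

Lemma CX_norm_ub f x : cabs (f x) <= CX_norm f.
Proof. by apply: (sup_upper_bound (CX_has_sup f)); exists x. Qed.

Lemma CX_norm_le f (c : R) : (forall x, cabs (f x) <= c) -> CX_norm f <= c.
Proof.
move=> fc; apply: ge_sup; first by case: (CX_has_sup f).
by move=> _ [x _ <-].
Qed.

Lemma CX_norm_ge0 f : 0 <= CX_norm f.
Proof. exact: le_trans (cabs_ge0 _) (CX_norm_ub f point). Qed.

Fact CX_starK : involutive CX_star.
Proof. by move=> f; apply: CXP => x; exact: conjCK. Qed.
Fact CX_starD f g : CX_star (f + g) = CX_star f + CX_star g.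
Proof. by apply: CXP => x; exact: rmorphD. Qed.
Fact CX_starM f g : CX_star (f * g) = CX_star g * CX_star f.
Proof. by apply: CXP => x; rewrite [RHS]mulrC; exact: rmorphM. Qed.
Fact CX_starZ (a : R[i]) f : CX_star (a *: f) = a^* *: CX_star f.
Proof. by apply: CXP => x; exact: rmorphM. Qed.

Fact CX_norm_eq0 f : CX_norm f = 0 -> f = 0.
Proof.
move=> f0; apply: CXP => x; apply: cabs_eq0; apply/eqP.
by rewrite eq_le cabs_ge0 andbT -f0 CX_norm_ub.
Qed.

Fact CX_normD f g : CX_norm (f + g) <= CX_norm f + CX_norm g.
Proof.
by apply: CX_norm_le => x; rewrite (le_trans (cabsD _ _))// lerD// CX_norm_ub.
Qed.

Fact CX_normM f g : CX_norm (f * g) <= CX_norm f * CX_norm g.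
Proof.
apply: CX_norm_le => x; rewrite [cabs _]cabsM.
by rewrite ler_pM ?cabs_ge0 ?CX_norm_ub.
Qed.

Fact CX_normZ (a : R[i]) f : CX_norm (a *: f) = cabs a * CX_norm f.
Proof.
apply/eqP; rewrite eq_le; apply/andP; split.
  apply: CX_norm_le => x; rewrite [cabs _]cabsM.
  by rewrite ler_wpM2l ?cabs_ge0 ?CX_norm_ub.
have [->|a0] := eqVneq (cabs a) 0; first by rewrite mul0r CX_norm_ge0.
have {}a0 : 0 < cabs a by rewrite lt_def a0 cabs_ge0.
rewrite mulrC -ler_pdivlMr//; apply: CX_norm_le => x.
by rewrite ler_pdivlMr// mulrC -cabsM; exact: (CX_norm_ub (a *: f)).
Qed.

Fact CX_cstar f : CX_norm (CX_star f * f) = CX_norm f ^+ 2.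
Proof.
have E x : cabs ((CX_star f * f) x) = cabs (f x) ^+ 2.
  by rewrite [LHS]cabsM cabsJ expr2.
apply/eqP; rewrite eq_le; apply/andP; split.
  by apply: CX_norm_le => x; rewrite E lerXn2r ?nnegrE ?cabs_ge0 ?CX_norm_ge0
    ?CX_norm_ub.
rewrite -[leRHS]sqr_sqrtr ?CX_norm_ge0//.
rewrite lerXn2r ?nnegrE ?CX_norm_ge0 ?sqrtr_ge0//.
apply: CX_norm_le => x; rewrite -[leLHS]ger0_norm ?cabs_ge0// -sqrtr_sqr -E.
by apply: ler_wsqrtr; rewrite CX_norm_ub.
Qed.

Fact CX_complete (u : nat -> CX R X) :
  (forall e, 0 < e -> exists N, forall m n,
     (N <= m)%N -> (N <= n)%N -> CX_norm (u m - u n) < e) ->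
  exists l, forall e, 0 < e -> exists N, forall n,
     (N <= n)%N -> CX_norm (u n - l) < e.
Proof.
move=> cu; have pt x : exists l : R[i], forall e : R, 0 < e -> exists N,
    forall n, (N <= n)%N -> cabs (u n x - l) < e.
  apply: cauchy_complex => e /cu[N NP]; exists N => m n Nm Nn.
  exact: le_lt_trans (CX_norm_ub (u m - u n) x) (NP _ _ Nm Nn).
pose l x := projT1 (cid (pt x)).
have lP x (e : R) : 0 < e ->
    exists N, forall n, (N <= n)%N -> cabs (u n x - l x) < e.
  exact: (projT2 (cid (pt x))).
have unif (e : R) : 0 < e ->
    exists N, forall n, (N <= n)%N -> forall x, cabs (u n x - l x) <= e.
  move=> e0; have e20 : 0 < e / 2 by rewrite divr_gt0.
  have [N NP] := cu _ e20; exists N => n Nn x.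
  have [M MP] := lP x _ e20; pose k := maxn N M.
  have -> : u n x - l x = (u n x - u k x) + (u k x - l x).
    by rewrite addrA subrK.
  rewrite (splitr e) (le_trans (cabsD _ _))// lerD// ltW//.
    apply: le_lt_trans (CX_norm_ub (u n - u k) x) _.
    by rewrite NP// leq_maxl.
  by rewrite MP// leq_maxr.
have cl : continuous l.
  apply/continuous_cabsP => x e e0.
  have e30 : 0 < e / 3 by rewrite divr_gt0.
  have [N /(_ N (leqnn N)) NP] := unif _ e30.
  have /continuous_cabsP/(_ x _ e30) := @CX_continuous (u N).
  apply: filterS => y uxy.
  have -> : l x - l y = (l x - u N x) + (u N x - u N y) + (u N y - l y).
    by rewrite !addrA !subrK.
  have -> : e = e / 3 + e / 3 + e / 3.
    by rewrite -!mulrDl -mulr2n -mulrSr -[e *+ 3]mulr_natr mulfK ?pnatr_eq0.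
  rewrite (le_lt_trans (cabsD _ _))// ltr_leD//.
  rewrite (le_lt_trans (cabsD _ _))// ler_ltD//.
  by rewrite cabsB.
exists (mkCX cl) => e e0; have e20 : 0 < e / 2 by rewrite divr_gt0.
have [N NP] := unif _ e20; exists N => n /NP uP.
apply: le_lt_trans (_ : e / 2 < e).
  by apply: CX_norm_le => x; exact: uP.
by rewrite ltr_pdivrMr// ltr_pMr// ltr1n.
Qed.

HB.instance Definition _ := isCStarAlgebra.Build R (CX R X)
  CX_starK CX_starD CX_starM CX_starZ CX_norm_eq0 CX_normD CX_normZ CX_normM
  CX_cstar CX_complete.

End CX_algebra.
Coercion CX_fun : CX >-> Funclass.

(* Structures for the language of unital C*-algebras with one more unary
   function symbol sigma.  In continuous logic a function symbol carries a
   modulus of uniform continuity and a bound on each domain of quantification;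
   those of sigma are the ones of automorphisms: 1-Lipschitz, and mapping the
   ball of radius r into itself. *)
Record Lstructure (R : realType) := LStructure {
  Lalg :> cstarType R;
  Lsigma : Lalg -> Lalg;
  Lsigma_lip : forall x y, cnorm (Lsigma x - Lsigma y) <= cnorm (x - y);
  Lsigma_ball : forall (r : nat) x,
    cnorm x <= r%:R -> cnorm (Lsigma x) <= r%:R
}.

Section syntax.
Variable R : realType.

Inductive term (n : nat) :=
| Var of 'I_n
| Zero
| One
| Add of term n & term n
| Mul of term n & term n
| Scale of R[i] & term n
| Star of term n
| Sigma of term n.

(* [formula n] has its free variables indexed by 'I_n.  Connectives are all the
   continuous functions R^k -> R; quantifiers range over the closed balls of
   natural radius and bind the variable of index 0. *)
Inductive formula : nat -> Type :=
| Norm n of term n : formula n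
| Connective n k of continuousType 'rV[R]_k R & ('I_k -> formula n) : formula n
| Sup n (r : nat) of formula n.+1 : formula n
| Inf n (r : nat) of formula n.+1 : formula n.

Definition sentence := formula 0.

End syntax.

Section semantics.
Variables (R : realType) (M : Lstructure R).

Definition env_cons n (x : M) (v : 'I_n -> M) (i : 'I_n.+1) : M :=
  oapp v x (unlift ord0 i).

Fixpoint teval n (v : 'I_n -> M) (t : term R n) : M :=
  match t with
  | Var i => v i
  | Zero => 0
  | One => 1
  | Add s t => teval v s + teval v t
  | Mul s t => teval v s * teval v t
  | Scale a t => a *: teval v t
  | Star t => star (teval v t)
  | Sigma t => Lsigma (teval v t)
  end.

(* The sets below are nonempty and bounded, so [sup] and [inf] are the true
   supremum and infimum. *)
Fixpoint feval n (phi : formula R n) : ('I_n -> M) -> R :=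
  match phi in formula _ n return ('I_n -> M) -> R with
  | Norm _ t => fun v => cnorm (teval v t)
  | Connective _ _ u phis => fun v => u (\row_i feval (phis i) v)
  | Sup _ r psi => fun v =>
      sup [set feval psi (env_cons x v) | x in [set x : M | cnorm x <= r%:R]]
  | Inf _ r psi => fun v =>
      inf [set feval psi (env_cons x v) | x in [set x : M | cnorm x <= r%:R]]
  end.

Definition empty_env (i : 'I_0) : M := 0.

Definition sentence_value (phi : sentence R) : R := feval phi empty_env.

End semantics.

Definition elementarily_equivalent (R : realType) (M N : Lstructure R) : Prop :=
  forall phi : sentence R, sentence_value M phi = sentence_value N phi.

(* A theory is a set of closed conditions phi = 0. *)
Definition theory (R : realType) := set (sentence R).

Definition satisfies (R : realType) (M : Lstructure R) (T : theory R) : Prop :=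
  forall phi, T phi -> sentence_value M phi = 0.

Definition complete_theory (R : realType) (T : theory R) : Prop :=
  forall M N : Lstructure R,
    satisfies M T -> satisfies N T -> elementarily_equivalent M N.

Definition theory_of (R : realType) (K : Lstructure R -> Prop) : theory R :=
  [set phi | forall M, K M -> sentence_value M phi = 0].

Definition axiomatizes (R : realType) (T : theory R)
    (K : Lstructure R -> Prop) : Prop :=
  forall M, satisfies M T <-> K M.

Record star_isomorphism (R : realType) (A B : cstarType R) (h : A -> B)
    : Prop := StarIsomorphism {
  star_iso1 : h 1 = 1;
  star_isoD : forall x y, h (x + y) = h x + h y;
  star_isoM : forall x y, h (x * y) = h x * h y;
  star_isoZ : forall (a : R[i]) x, h (a *: x) = a *: h x;
  star_iso_star : forall x, h (star x) = star (h x);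
  star_iso_bij : bijective h
}.

Definition Lisomorphic (R : realType) (M N : Lstructure R) : Prop :=
  exists h : M -> N,
    [/\ star_isomorphism h,
        forall x, cnorm (h x) = cnorm x &
        forall x, h (Lsigma x) = Lsigma (h x)].

(* [cantor_like] from the library: perfect, compact, Hausdorff and
   zero-dimensional (not necessarily metrizable). *)
Definition CantorA_structure (R : realType) (M : Lstructure R) : Prop :=
  exists (X : compact_space) (sigma : CX R X -> CX R X)
    (lip : forall f g, cnorm (sigma f - sigma g) <= cnorm (f - g))
    (ball : forall (r : nat) f, cnorm f <= r%:R -> cnorm (sigma f) <= r%:R),
    [/\ cantor_like X,
        star_isomorphism sigma &
        Lisomorphic M (LStructure lip ball)].

(* Any theory axiomatizing the class has the same models as this one: see
   [axiomatizes_theory_of]. *)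
Definition T_CantorA (R : realType) : theory R :=
  theory_of (@CantorA_structure R).
Arguments T_CantorA R : clear implicits.

Lemma axiomatizes_theory_of (R : realType) (T : theory R)
    (K : Lstructure R -> Prop) :
  axiomatizes T K -> axiomatizes (theory_of K) K.
Proof.
move=> TK M; split=> [MK|KM phi]; last exact.
by apply/TK => phi Tphi; apply: MK => N /TK; exact.
Qed.

Definition homeomorphism (X Y : topologicalType) (h : X -> Y) : Prop :=
  continuous h /\ exists g : Y -> X, [/\ continuous g, cancel h g & cancel g h].

Definition homeomorphic (X Y : topologicalType) : Prop :=
  exists h : X -> Y, homeomorphism h.

Record dynamical_system := DynamicalSystem {
  ds_space :> compact_space;
  ds_map : ds_space -> ds_space;
  ds_homeo : homeomorphism ds_map
}.

Section induced_structure.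
Variables (R : realType) (S : dynamical_system).

Fact CX_pullback_cts (f : CX R S) : continuous (fun x => f (ds_map x)).
Proof.
move=> x; apply: continuous_comp; first by case: (ds_homeo S) => cS _; exact: cS.
exact: CX_continuous.
Qed.

Definition CX_pullback (f : CX R S) : CX R S := mkCX (@CX_pullback_cts f).

Fact CX_pullback_lip (f g : CX R S) :
  cnorm (CX_pullback f - CX_pullback g) <= cnorm (f - g).
Proof. by apply: CX_norm_le => x; exact: (CX_norm_ub (f - g)). Qed.

Fact CX_pullback_ball (r : nat) (f : CX R S) :
  cnorm f <= r%:R -> cnorm (CX_pullback f) <= r%:R.
Proof. by apply: le_trans; apply: CX_norm_le => x; exact: (CX_norm_ub f). Qed.

Definition CX_structure : Lstructure R :=
  LStructure CX_pullback_lip CX_pullback_ball.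

End induced_structure.

Definition odometer_space (a : nat -> nat) : topologicalType :=
  prod_topology (fun n => discrete_topology 'I_(a n)).

(* Addition of 1 at coordinate 0 with carry to the right: coordinate n receives
   a carry iff all the previous ones are maximal, and [ordS] is the successor
   modulo [a n]. *)
Definition odometer_map (a : nat -> nat) (b : odometer_space a) :
    odometer_space a :=
  fun n => if [forall k : 'I_n, b k == (a k).-1 :> nat] then ordS (b n) else b n.

Definition is_odometer (S : dynamical_system) : Prop :=
  exists2 a : nat -> nat, (forall n, (2 <= a n)%N) &
  exists2 h : S -> odometer_space a, homeomorphism h &
    forall x, h (ds_map x) = odometer_map (h x).

(* Main.v *)
(* The 2-adic and the 3-adic odometers are told apart by the sentence

     inf_{|f| <= 1} | (f + f^* ) sigma(f + f^* ) + 1 |.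

   Since f + f^* is real valued, a small value yields a continuous real
   function r whose sign alternates along every orbit.  For bases a_n with a_0
   even, r(x) = (-1)^(x_0) does, and the infimum is 0.  If all the a_n are odd,
   sigma^(a_0 ... a_(n-1))(0) tends to 0 along odd times, so r cannot
   alternate, and the infimum is at least 1. *)
Require Import Defs.
From HB Require Import structures.
From mathcomp Require Import all_boot all_order all_algebra complex.
From mathcomp Require Import all_classical all_reals.
From mathcomp Require Import topology normedtype sequences cantor.

Set Implicit Arguments.
Unset Strict Implicit.
Unset Printing Implicit Defensive.
Import Order.TTheory GRing.Theory Num.Theory.
Import numFieldTopology.Exports numFieldNormedType.Exports.
Local Open Scope classical_set_scope.

(** * The odometer map as a homeomorphism *)

Lemma forall_ordSr n (P : pred nat) :
  [forall k : 'I_n.+1, P k] = [forall k : 'I_n, P k] && P n.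
Proof.
apply/forallP/andP => [PS|[/forallP Pn PSn] i].
  split; last exact: (PS ord_max).
  by apply/forallP => i; exact: (PS (widen_ord (leqnSn n) i)).
have := ltn_ord i; rewrite ltnS leq_eqVlt => /predU1P[->//|ltin].
exact: (Pn (Ordinal ltin)).
Qed.

Lemma ordS_eq0 n (i : 'I_n) : (ordS i == 0%N :> nat) = (i == n.-1 :> nat).
Proof.
case: n i => [[]//|n i] /=; have := ltn_ord i; rewrite ltnS leq_eqVlt.
case/predU1P => [->|ltin]; first by rewrite modnn !eqxx.
by rewrite modn_small ?ltnS// (ltn_eqF ltin).
Qed.

Section odometer_topology.
Context {a : nat -> nat}.
Implicit Types b c : odometer_space a.

(** The product topology is the supremum of the topologies pulled back along the coordinates, and
    every factor is discrete. *)
Lemma odometer_space_cvg T (F : set_system T) (u : T -> odometer_space a) b :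
  Filter F -> (forall n, \forall t \near F, u t n = b n) -> u @ F --> b.
Proof.
move=> FF ub; apply/cvg_sup => n U [V] [[W] oW <-] Wb WU.
by apply: filterS (ub n) => t utb; apply: WU; rewrite /= utb.
Qed.

Lemma near_odometer_space b n :
  \forall c \near b, forall k, (k < n)%N -> c k = b k.
Proof.
elim: n => [|n IH]; first by near=> c.
have bn : \forall c \near b, c n = b n.
  exact: (@proj_continuous _ (fun i => discrete_topology 'I_(a i)) n b _
    (discrete_set1 (b n))).
near=> c => k; rewrite ltnS leq_eqVlt => /predU1P[->|].
  exact: (near bn c).
by move: k; near: c.
Unshelve. all: end_near. Qed.

Lemma continuous_prefix_dependent (T : topologicalType)
    (f : odometer_space a -> T) b :
  (exists n, forall c, (forall k, (k < n)%N -> c k = b k) -> f c = f b) ->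
  {for b, continuous f}.
Proof.
move=> [n fP] U /nbhs_singleton Ub.
by apply: filterS (near_odometer_space b n) => c /fP /= ->.
Qed.

Lemma continuous_odometer_map : continuous (@odometer_map a).
Proof.
move=> b; apply: (@odometer_space_cvg _ (nbhs b)) => n.
apply: filterS (near_odometer_space b n.+1) => c cb.
rewrite /odometer_map cb//; congr (if _ then _ else _).
by apply: eq_forallb => k; rewrite cb// ltnW// ltnS.
Qed.

(** Subtraction of 1 with borrow to the right, the inverse of [odometer_map]. *)
Definition odometer_pred b : odometer_space a :=
  fun n => if [forall k : 'I_n, b k == 0%N :> nat] then ord_pred (b n) else b n.

Lemma continuous_odometer_pred : continuous odometer_pred.
Proof.
move=> b; apply: (@odometer_space_cvg _ (nbhs b)) => n.
apply: filterS (near_odometer_space b n.+1) => c cb.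
rewrite /odometer_pred cb//; congr (if _ then _ else _).
by apply: eq_forallb => k; rewrite cb// ltnW// ltnS.
Qed.

(** This makes the two maps cancel coordinatewise: a borrow reaches coordinate n of the image
    exactly when a carry reached it in [b]. A digit that receives a carry becomes 0 iff it was
    maximal. *)
Lemma carry_odometer_map b n :
  [forall k : 'I_n, odometer_map b k == 0%N :> nat] =
  [forall k : 'I_n, b k == (a k).-1 :> nat].
Proof.
elim: n => [|n IH]; first by apply/idP/idP => _; apply/forallP => -[].
rewrite (forall_ordSr n (fun k => odometer_map b k == 0%N :> nat)).
rewrite (forall_ordSr n (fun k => b k == (a k).-1 :> nat)) IH.
by rewrite /odometer_map; case: ifP => //= _; rewrite -ordS_eq0.
Qed.

Lemma borrow_odometer_pred b n :
  [forall k : 'I_n, odometer_pred b k == (a k).-1 :> nat] =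
  [forall k : 'I_n, b k == 0%N :> nat].
Proof.
elim: n => [|n IH]; first by apply/idP/idP => _; apply/forallP => -[].
rewrite (forall_ordSr n (fun k => odometer_pred b k == (a k).-1 :> nat)).
rewrite (forall_ordSr n (fun k => b k == 0%N :> nat)) IH.
rewrite /odometer_pred; case: ifP => // _.
by rewrite !andTb -ordS_eq0 ord_predK.
Qed.

Lemma odometer_mapK : cancel (@odometer_map a) odometer_pred.
Proof.
move=> b; apply: functional_extensionality_dep => n.
rewrite /odometer_pred carry_odometer_map /odometer_map.
by case: [forall k, _] => //=; rewrite ordSK.
Qed.

Lemma odometer_predK : cancel odometer_pred (@odometer_map a).
Proof.
move=> b; apply: functional_extensionality_dep => n.
rewrite /odometer_map borrow_odometer_pred /odometer_pred.
by case: [forall k, _] => //=; rewrite ord_predK.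
Qed.

Lemma homeomorphism_odometer_map : homeomorphism (@odometer_map a).
Proof.
split; first exact: continuous_odometer_map.
exists odometer_pred; split; [exact: continuous_odometer_pred|
  exact: odometer_mapK|exact: odometer_predK].
Qed.

End odometer_topology.

(* The bases are a_n = d n + 2, so that the coordinate types 'I_(a n) are
   inhabited. *)
Definition pointed_odometer_space (d : nat -> nat) : Type :=
  prod_topology (fun n => discrete_topology 'I_(d n).+2).
HB.instance Definition _ d := Uniform.on (pointed_odometer_space d).
HB.instance Definition _ (R : realType) d : @PseudoMetric R _ :=
  @PseudoMetric.on (pointed_odometer_space d).
HB.instance Definition _ d :=
  isPointed.Build (pointed_odometer_space d) (fun=> ord0).

(** * Odometers as dynamical systems on the Cantor set *)

Section odometer.
Variable d : nat -> nat.
Local Notation a := (fun n => (d n).+2).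

Lemma cantor_like_odometer_space : cantor_like (odometer_space a).
Proof.
pose K n := discrete_topology 'I_(a n); split.
(* No point is isolated: each factor has two distinct points, so a point can be altered at
   arbitrarily late coordinates. *)
- by apply: (@perfect_diagonal K) => n; exists (ord0, ord_max).
- have cptK n : compact [set: K n].
    by apply: finite_compact; exact: (@finite_finset 'I_(a n)).
  have := tychonoff cptK.
  by congr compact; rewrite eqEsubset.
- by apply: (@hausdorff_product _ K) => n; exact: discrete_hausdorff.
- by apply: (@zero_dimension_prod _ K) => n; exact: discrete_zero_dimension.
Qed.

Lemma odometer_space_compact : compact [set: odometer_space a].
Proof. by case: cantor_like_odometer_space. Qed.

Lemma odometer_space_hausdorff : hausdorff_space (odometer_space a).
Proof. by case: cantor_like_odometer_space. Qed.

Definition odometer_compact_space : compact_space :=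
  @CompactSpace (pointed_odometer_space d)
    odometer_space_compact odometer_space_hausdorff.

Definition odometer_system : dynamical_system :=
  @DynamicalSystem odometer_compact_space _ (@homeomorphism_odometer_map a).

Lemma odometer_system_is_odometer : is_odometer odometer_system.
Proof.
exists a => //; exists id => //; split; first by move=> b; exact: cvg_id.
by exists id; split => // b; exact: cvg_id.
Qed.

(** Brouwer's characterization of the Cantor set gives a continuous closed bijection from
    [cantor_space]; closedness is continuity of its inverse. [R] carries the pseudometric on the
    countable product. *)
Lemma homeomorphic_odometer_cantor (R : realType) :
  homeomorphic odometer_system cantor_space.
Proof.
have [f [fcts fclosed]] :=
  @homeomorphism_cantor_like R (pointed_odometer_space d)
    cantor_like_odometer_space.
have f1K : cancel f^-1 f by move=> x; rewrite invK// inE.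
have fK : cancel f f^-1 by move=> x; rewrite funK// inE.
exists f^-1; split; last by exists f.
apply/continuous_closedP => A /fclosed; congr closed.
rewrite eqEsubset; split=> [_ [x Ax <-]|x Ax]; first by rewrite /preimage /= fK.
by exists (f^-1 x).
Qed.

End odometer.

Local Open Scope nat_scope.

(** * Mixed-radix expansions and the orbit of zero *)

Section odometer_of_nat.
Variable a : nat -> nat.
Hypothesis a_gt0 : forall n, 0 < a n.

(** The place value of digit n. *)
Let P n := \prod_(i < n) a i.

Let PS n : P n.+1 = P n * a n.
Proof. exact: big_ord_recr. Qed.

Let P_gt0 n : 0 < P n.
Proof. exact: prodn_gt0. Qed.

(** The mixed-radix digits of k, hence the point reached from zero after k steps. *)
Definition odometer_of_nat k : odometer_space a :=
  fun n => Ordinal (ltn_pmod (k %/ P n) (a_gt0 n)).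

(** The first n digits of k are all maximal iff k is -1 modulo [P n]. In that case k.+1 %/ [P n] is
    one more than k %/ [P n], so digit n is maximal too iff [a n] divides the new quotient. *)
Lemma odometer_of_nat_carry k n :
  [forall j : 'I_n, odometer_of_nat k j == (a j).-1 :> nat] = (P n %| k.+1).
Proof.
elim: n => [|n IH]; first by rewrite /P big_ord0 dvd1n; apply/forallP => -[].
rewrite (forall_ordSr n (fun j => odometer_of_nat k j == (a j).-1 :> nat)) IH.
rewrite PS; have [Pk|/negPf nPk] := boolP (P n %| k.+1); last first.
  apply/esym/negbTE; apply: contraFN nPk; apply: dvdn_trans; exact: dvdn_mulr.
rewrite -ordS_eq0 /= -addn1 modnDml addn1 -/(dvdn _ _).
by rewrite -[in RHS](divnK Pk) [_ * a n]mulnC dvdn_pmul2r// divnS// Pk.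
Qed.

Lemma odometer_map_of_nat k :
  odometer_map (odometer_of_nat k) = odometer_of_nat k.+1.
Proof.
apply: functional_extensionality_dep => n; apply: val_inj.
rewrite /odometer_map odometer_of_nat_carry /= divnS//.
case: ifP => //= _.
by rewrite -addn1 modnDml addnC.
Qed.

Lemma cvg_odometer_of_nat :
  odometer_of_nat (P n) @[n --> \oo] --> odometer_of_nat 0.
Proof.
apply: odometer_space_cvg => j; exists j.+1 => // n /= jn; apply: val_inj => /=.
rewrite div0n mod0n; apply/eqP.
(* For j < n this divisibility makes digit j of [P n] vanish. *)
have /dvdnP[q ->] : P j.+1 %| P n.
  elim: n jn => // n IH; rewrite leq_eqVlt => /predU1P[->//|/IH jn].
  by apply: dvdn_trans jn _; rewrite (PS n) dvdn_mulr.
by rewrite PS mulnCA mulKn// modnMl.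
Qed.

End odometer_of_nat.

Local Open Scope ring_scope.
Local Open Scope complex_scope.

(** * The obstruction for odd bases *)

Lemma odd_odometer_sign (R : realType) (d : nat -> nat)
    (r : odometer_system d -> R) :
    (forall n, odd (d n)) -> continuous r ->
  exists x, 0 <= r x * r (ds_map x).
Proof.
move=> dodd rcts; apply/not_existsP => rneg.
pose a n := (d n).+2; have a_gt0 n : (0 < a n)%N by [].
pose u := odometer_of_nat a_gt0 : nat -> odometer_system d.
(* If the claim fails, consecutive values of [r] have negative product, so [r] never vanishes and
   its sign flips at each step. *)
have uS k : Num.sg (r (u k.+1)) = - Num.sg (r (u k)).
  have uE : ds_map (u k) = u k.+1 by exact: (odometer_map_of_nat a_gt0).
  have /negP := rneg (u k); rewrite -ltNge uE => uneg.
  have r0 : r (u k) != 0 by apply: contraTneq uneg => ->; rewrite mul0r ltxx.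
  have sg2 : Num.sg (r (u k)) ^+ 2 = 1 by rewrite sqr_sg r0.
  by rewrite -[LHS]mul1r -sg2 expr2 -mulrA -sgrM (ltr0_sg uneg) mulrN1.
have sgu k : Num.sg (r (u k)) = (-1) ^+ k * Num.sg (r (u 0%N)).
  by elim: k => [|k IH]; rewrite ?expr0 ?mul1r// uS IH exprS mulN1r mulNr.
have r0 : r (u 0%N) != 0.
  by have /negP := rneg (u 0%N); apply: contraNneq => ->; rewrite mul0r.
(* The factor [r (u 0)] makes the limit positive whatever the sign of [r (u 0)]. *)
have cvgr :
    r (u (\prod_(i < n) a i)%N) * r (u 0%N) @[n --> \oo] --> r (u 0%N) ^+ 2.
  apply: cvgMl; have ucvg := @cvg_odometer_of_nat a a_gt0.
  exact: (@cvg_comp _ _ _ _ r _ _ _ ucvg (rcts (u 0%N))).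
have /(cvgr_gt _ cvgr)[n _ /(_ n (leqnn n))] : 0 < r (u 0%N) ^+ 2.
  by rewrite exprn_even_gt0.
rewrite -sgr_gt0 sgrM sgu -signr_odd.
(* The base [d n + 2] has the parity of [d n]. After an odd number of steps the sign is reversed, so
   the product is negative, against its positive limit. *)
have -> : odd (\prod_(i < n) a i).
  elim: n => [|n IH]; first by rewrite big_ord0.
  by rewrite big_ord_recr oddM IH /= negbK dodd.
by rewrite expr1 mulN1r mulNr -sgrM -expr2 oppr_gt0 sgr_lt0 ltNge sqr_ge0.
Qed.

(** * Bounds on the value of the sentence *)

Section sentence.
Variable R : realType.

Definition alternation_term : term R 1 :=
  let h := Add (Var R ord0) (Star (Var R ord0)) in
  Add (Mul h (Sigma h)) (One R 1).

Definition alternation : sentence R := Inf 1 (Norm alternation_term).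

Variable S : dynamical_system.
Implicit Type f : CX_structure R S.

(** This is f + f^* seen as a real-valued function. *)
Definition double_Re f (x : S) : R := complex.Re ((f : CX R S) x) *+ 2.

Lemma continuous_double_Re f : continuous (double_Re f).
Proof.
move=> x; apply: cvgMn; apply/cvgrPdist_lt => e e0.
have /continuous_cabsP/(_ x e e0) := @CX_continuous R S f.
apply: filterS => y; apply: le_lt_trans.
by rewrite -raddfB ler_cabs_Re.
Qed.

Lemma cabs_real (p : R) : cabs p%:C = `|p|.
Proof. by rewrite /cabs normc_def /= expr0n addr0 sqrtr_sqr. Qed.

Lemma add_conjC (z : R[i]) : z + z^* = (complex.Re z *+ 2)%:C.
Proof.
by case: z => p q; apply/eqP; rewrite eq_complex /= -mulr2n subrr !eqxx.
Qed.

Lemma alternation_termE f x :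
  (teval (env_cons f (@empty_env _ _)) alternation_term : CX R S) x =
  (double_Re f x * double_Re f (ds_map x) + 1)%:C.
Proof.
rewrite rmorphD rmorphM rmorph1 /= -!add_conjC.
by rewrite /env_cons unlift_none.
Qed.

Lemma alternation_ge1 :
  (forall r : S -> R, continuous r -> exists x, 0 <= r x * r (ds_map x)) ->
  1 <= sentence_value (CX_structure R S) alternation.
Proof.
move=> Sr; apply: lb_le_inf.
  (* The lower bound passes to [inf] only over a nonempty set; 0 lies in the unit ball. *)
  apply: image_nonempty; exists 0 => /=.
  by apply: CX_norm_le => x; rewrite cabs0.
move=> _ [f _ <-] /=; have [x x0] := Sr _ (@continuous_double_Re f).
apply: le_trans (CX_norm_ub _ x); rewrite alternation_termE.
apply: le_trans (ler_cabs_Re _) => /=.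
by rewrite ger0_norm ?lerDr// addr_ge0.
Qed.

Lemma alternation_le0 (r : S -> R) :
  continuous r -> (forall x, r (ds_map x) = - r x) -> (forall x, `|r x| = 1) ->
  sentence_value (CX_structure R S) alternation <= 0.
Proof.
move=> rcts rS r1.
(* The witness is r / 2: then f + f^* = r, the norm is at most 1/2, and the term is 1 - r^2 = 0. *)
have fcts : continuous (fun x => (r x / 2)%:C : R[i]).
  apply/continuous_cabsP => x e e0.
  have /cvgrPdist_lt/(_ e e0) : (r y / 2 @[y --> x] --> r x / 2).
    by apply: cvgMl; exact: rcts.
  by apply: filterS => y; rewrite -rmorphB cabs_real.
pose f : CX_structure R S := mkCX fcts.
have rE x : double_Re f x = r x.
  by rewrite [RHS]splitr -mulr2n.
apply: ge_inf.
  by exists 0 => _ [g _ <-]; exact: CX_norm_ge0.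
exists f => /=.
  apply: CX_norm_le => x; rewrite cabs_real normrM r1 mul1r.
  by rewrite normfV normr_nat invf_le1// ler1n.
apply: le_anti; rewrite [X in _ && X]CX_norm_ge0 andbT; apply: CX_norm_le => x.
rewrite alternation_termE !rE rS mulrN -expr2 -real_normK ?num_real// r1.
by rewrite expr1n addNr cabs0.
Qed.

End sentence.

(** * The alternating function for an even first base, and the conclusion *)

Lemma even_odometer_sign (R : realType) (d : nat -> nat) :
    ~~ odd (d 0%N) ->
  exists r : odometer_system d -> R,
    [/\ continuous r, forall x, r (ds_map x) = - r x & forall x, `|r x| = 1].
Proof.
move=> d0; exists (fun x => (-1) ^+ (x 0%N : nat)); split.
- move=> x; apply: (@continuous_prefix_dependent (fun n => (d n).+2)).
  by exists 1%N => y ->.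
- move=> x; rewrite -[RHS]mulN1r -exprS -[LHS]signr_odd -[RHS]signr_odd.
  congr (_ ^+ _); rewrite /= /odometer_map.
  (* At coordinate 0 the carry condition is vacuous, so this digit always advances. Reduction modulo
     the even base preserves parity, so its parity flips even on wrap-around. *)
  rewrite (introT forallP) => [|[]//] /=.
  by rewrite odd_mod//= negbK; exact: negbTE.
- by move=> x; rewrite normrX normrN1 expr1n.
Qed.

Lemma CX_structure_CantorA (R : realType) (S : dynamical_system) :
  cantor_like S -> CantorA_structure (CX_structure R S).
Proof.
move=> Scantor; exists S, (@CX_pullback R S), (@CX_pullback_lip R S),
  (@CX_pullback_ball R S); split => //.
  split => //; try by move=> *; apply: CXP.
  (* Only bijectivity remains; the inverse is composition with the inverse homeomorphism. *)
  have [_ [g [gcts gK Kg]]] := ds_homeo S.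
  have fg_cts (f : CX R S) : continuous (fun x => f (g x)).
    by move=> x; apply: continuous_comp; [exact: gcts|exact: CX_continuous].
  exists (fun f => mkCX (fg_cts f)) => f; apply: CXP => x.
    by congr (f _); exact: Kg.
  by congr (f _); exact: gK.
exists id; split => //; split => //.
by exists id.
Qed.

Local Close Scope ring_scope.

Theorem theorem2p2 (R : realType) :
  (exists X Y : dynamical_system,
    [/\ is_odometer X,
        is_odometer Y,
        homeomorphic X cantor_space,
        homeomorphic Y cantor_space &
        ~ elementarily_equivalent (CX_structure R X) (CX_structure R Y)])
  /\ ~ complete_theory (T_CantorA R)
  /\ (forall T : theory R,
        axiomatizes T (@CantorA_structure R) -> ~ complete_theory T).
Proof.
(* All bases are 2 for [X] and 3 for [Y]. *)
pose X := odometer_system (fun=> 0); pose Y := odometer_system (fun=> 1).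
have nXY : ~ elementarily_equivalent (CX_structure R X) (CX_structure R Y).
  have [//|r [rcts rS r1]] := @even_odometer_sign R (fun=> 0).
  move=> /(_ (alternation R)) E; have := alternation_le0 rcts rS r1.
  rewrite E; apply/negP; rewrite -ltNge (lt_le_trans ltr01)//.
  by apply: alternation_ge1 => s; exact: odd_odometer_sign.
have KX : CantorA_structure (CX_structure R X).
  by apply: CX_structure_CantorA; exact: cantor_like_odometer_space.
have KY : CantorA_structure (CX_structure R Y).
  by apply: CX_structure_CantorA; exact: cantor_like_odometer_space.
split.
  exists X, Y; split => //; try exact: odometer_system_is_odometer.
    exact: (homeomorphic_odometer_cantor _ R).
  exact: (homeomorphic_odometer_cantor _ R).
(* Both structures lie in the class, so they satisfy [T_CantorA] by its definition and [T] by [TK];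
   completeness would make them elementarily equivalent. *)
split=> [cT|T TK cT]; apply/nXY/cT; try by move=> phi; apply.
  exact/TK.
exact/TK.
Qed.
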